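(* Let $n$ be the order of the system. The number of candidate sequences in $S^+$ is $$\begin{cases}\displaystyle \binom{n}{\frac{n-2}{2}}+2\binom{n}{\frac n2}+\binom{n+1}{\frac n2}-3 & \text{for } n \text{ even},\\[2mm] \displaystyle 3\binom{n}{\frac{n-1}{2}}+\binom{n+1}{\frac{n+1}{2}}-3 & \text{for } n\text{ odd}.\end{cases}$$
   Context: Let $\mathcal{S}$ be the set of all finite non-empty sequences over $\{-1,0,+1\}$ such that the last entry is non-zero and, of any two consecutive entries, exactly one is equal to $0$. (So zero and non-zero entries alternate, the first entry may be zero or non-zero, and there is no direct passage between $+1$ and $-1$.) Such a sequence records, in temporal order, the values of a bang-off-bang control $u$ for a single-input linear time-invariant system of order $n$, where $u$ is determined by a continuous switching function $\psi$ via $u=-\mathrm{sgn}(\psi)$ when $|\psi|>1$ and $u=0$ when $|\psi|<1$. For $s\in\mathcal{S}$ define: - $p(s)$: the number of pairs of consecutive entries of $s$ equal to $(0,-1)$ or $(-1,0)$ (the number of times $\psi$ takes the value $+1$); - $q(s)$: the number of pairs of consecutive entries of $s$ equal to $(0,+1)$ or $(+1,0)$ (the number of times $\psi$ takes the value $-1$); - $z(s)$: the number of triples of consecutive entries of $s$ equal to $(+1,0,-1)$ or $(-1,0,+1)$ (the minimum number of zeros of $\psi$ forced by $s$). For integers $p,q\ge 0$ with $p+q>1$, let $S^+_{p,q}$ be the set of all $s\in\mathcal{S}$ with $p(s)=p$, $q(s)=q$ that begin with $(+1,0)$ or $(0,+1,0)$. Let $$S^+=\bigcup_{\substack{0\le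 p\le n,\ 0\le q\le n\\ p+q>1}} S^+_{p,q}.$$ A sequence $s\in\mathcal{S}$ is called a candidate sequence if it meets the necessary conditions that the Pontryagin minimum principle imposes on the time-fuel optimal control of the system of order $n$ (whose system matrix has non-zero real eigenvalues). In terms of the counts above, these are: $p(s)\le n$, $q(s)\le n$ (so at most $2n$ switchings in total) and $z(s)\le n-1$. Within $S^+$, the only sequence violating these conditions is the alternating sequence $(+1,0,-1,0,(-1)^2,\dots,(-1)^{n-1},0,(-1)^n)$, for which $z=n$.
   Formalization: The formula exceeds the number of candidates in S^+ by 2 (for n = 1 there are none, but it gives 2), because p+q>1 excludes (+1) and (0,+1); the theorem counts the candidates in S^+ together with these two sequences. *)

(* Defs.v *)
From mathcomp Require Import all_boot ssralg ssrint.
From mathcomp Require Import classical_sets functions cardinality.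
Set Implicit Arguments.
Unset Strict Implicit.
Unset Printing Implicit Defensive.
Import GRing.Theory.
Local Open Scope ring_scope.
Local Open Scope classical_set_scope.

Definition control_seqs : set (seq int) :=
  [set s | [&& s != [::], all (mem [:: -1; 0; 1]) s, last 0 s != 0
             & sorted (fun a b => (a == 0) (+) (b == 0)) s]].

Definition pairs (s : seq int) : seq (int * int) := zip s (behead s).

Definition triples (s : seq int) : seq (int * int * int) :=
  zip (pairs s) (behead (behead s)).

(* p(s): number of times the switching function takes the value +1
   (recall u = - sgn psi, so these are the switchings to or from u = -1). *)
Definition pcount (s : seq int) : nat :=
  count (mem [:: (0, -1); (-1, 0)]) (pairs s).

(* q(s): number of times the switching function takes the value -1. *)
Definition qcount (s : seq int) : nat :=
  count (mem [:: (0, 1); (1, 0)]) (pairs s).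

(* z(s): number of zeros of the switching function forced by s. *)
Definition zcount (s : seq int) : nat :=
  count (mem [:: (1, 0, -1); (-1, 0, 1)]) (triples s).

Definition Splus_pq (p q : nat) : set (seq int) :=
  [set s | control_seqs s /\ pcount s = p /\ qcount s = q /\
           (prefix [:: 1; 0] s \/ prefix [:: 0; 1; 0] s)].

Definition Splus (n : nat) : set (seq int) :=
  \bigcup_(pq in [set pq : nat * nat |
                   [&& pq.1 <= n, pq.2 <= n & 1 < pq.1 + pq.2]%N])
    Splus_pq pq.1 pq.2.

(* The sequences (+1) and (0,+1), whose first non-zero entry is +1 and which
   have p + q <= 1.  They are not in [Splus n], but the closed formula for the
   number of candidates whose first non-zero entry is +1 counts them; without
   them the number is smaller by 2 (for n = 1, there would be no candidate). *)
Definition short_seqs : set (seq int) := [set [:: 1]; [:: 0; 1]].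

Definition candidate (n : nat) : set (seq int) :=
  [set s | control_seqs s /\
           [&& pcount s <= n, qcount s <= n & zcount s <= n - 1]%N].

(* Main.v *)
Require Import Defs.
From mathcomp Require Import all_boot ssralg ssrint zify.
From mathcomp Require Import classical_sets functions cardinality.
Local Open Scope classical_set_scope.
Local Open Scope card_scope.

(* A control sequence whose first non-zero entry is +1 amounts to a
   possible leading zero and a word of signs following that +1. With the last
   sign and the leading zero fixed, [p <= n] and [q <= n] bound separately the
   numbers of -1 and +1 among the remaining signs, and there are
   ['C(r + s, r) - 1] words with fewer than [r] letters of one kind and fewer
   than [s] of the other. The four cases, plus the two short sequences, minus
   the alternating sequence excluded by [z <= n - 1], give the formula. *)

(** * Coding of sequences by words of signs *)

Definition sgi (c : bool) : int := (if c then 1 else -1)%R.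

Fixpoint interleave (c : bool) (w : seq bool) : seq int :=
  if w is b :: w' then [:: sgi c, 0%R & interleave b w'] else [:: sgi c].

(* The Boolean records a leading zero; [w] lists the signs that follow the
   first one, which is +1. *)
Definition encode (x : bool * seq bool) : seq int :=
  nseq x.1 0%R ++ interleave true x.2.

(** * Switchings and sign changes of a code *)

Lemma interleave_cons c w : interleave c w = sgi c :: behead (interleave c w).
Proof. by case: w. Qed.

Lemma pcount_interleave_cons c b w :
  pcount (interleave c (b :: w)) = (~~ c + ~~ b + pcount (interleave b w))%N.
Proof.
rewrite /pcount /pairs /= (interleave_cons b w) /=.
by case: c; case: b.
Qed.

Lemma qcount_interleave_cons c b w :
  qcount (interleave c (b :: w)) = (c + b + qcount (interleave b w))%N.
Proof.
rewrite /qcount /pairs /= (interleave_cons b w) /=.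
by case: c; case: b.
Qed.

Lemma zcount_interleave_cons c b w :
  zcount (interleave c (b :: w)) = ((c != b) + zcount (interleave b w))%N.
Proof.
by rewrite /zcount /triples /pairs /=; case: w => [|b' w]; case: c; case: b.
Qed.

(** An interior sign is both entered from a zero and left for one, hence counts twice; the first
    sign is only left and the last one only entered. *)
Lemma pcount_interleave_rcons c v l :
  pcount (interleave c (rcons v l)) = (~~ c + (count negb v).*2 + ~~ l)%N.
Proof.
elim: v c => [|b v IHv] c;
  rewrite [rcons _ _]/= pcount_interleave_cons ?IHv /=; last by lia.
by rewrite /pcount /pairs /=; lia.
Qed.

Lemma qcount_interleave_rcons c v l :
  qcount (interleave c (rcons v l)) = (c + (count id v).*2 + l)%N.
Proof.
elim: v c => [|b v IHv] c;
  rewrite [rcons _ _]/= qcount_interleave_cons ?IHv /=; last by lia.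
by rewrite /qcount /pairs /=; lia.
Qed.

Lemma pqcount_interleave c w :
  (pcount (interleave c w) + qcount (interleave c w) = (size w).*2)%N.
Proof.
elim: w c => [|b w IHw] c //.
by rewrite pcount_interleave_cons qcount_interleave_cons [size _]/=; have := IHw b; lia.
Qed.

Lemma pcount_encode x : pcount (encode x) = pcount (interleave true x.2).
Proof. by case: x => [[] w] //; rewrite /encode /= interleave_cons. Qed.

(** A leading zero is followed by +1, so the one switching that it adds falls under [qcount]. *)
Lemma qcount_encode x :
  qcount (encode x) = (x.1 + qcount (interleave true x.2))%N.
Proof. by case: x => [[] w] //; rewrite /encode /= interleave_cons. Qed.

Lemma zcount_encode x : zcount (encode x) = zcount (interleave true x.2).
Proof. by case: x => [[] [|b w]]. Qed.

(** Here [c] is the sign preceding the word, so [(false, alternating true n)] codes the excluded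
    sequence. *)
Fixpoint alternating (c : bool) (n : nat) : seq bool :=
  if n is n'.+1 then ~~ c :: alternating (~~ c) n' else [::].

Lemma size_alternating c n : size (alternating c n) = n.
Proof. by elim: n c => //= n IHn c; rewrite IHn. Qed.

Lemma pcount_alternating c n : pcount (interleave c (alternating c n)) = n.
Proof.
by elim: n c => // n IHn c; rewrite pcount_interleave_cons IHn; case: c.
Qed.

Lemma zcount_interleave_le c w : (zcount (interleave c w) <= size w)%N.
Proof.
elim: w c => [|b w IHw] c //.
by rewrite zcount_interleave_cons /=; have := IHw b; lia.
Qed.

Lemma zcount_interleave_eq c w :
  (zcount (interleave c w) == size w) = (w == alternating c (size w)).
Proof.
elim: w c => [|b w IHw] c //.
rewrite zcount_interleave_cons /= eqseq_cons.
have := zcount_interleave_le b w; have := IHw b.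
by case: c; case: b => //= _ zw; apply/eqP; lia.
Qed.

(* Each switching enters or leaves a zero, so at most [2n] switchings leave
   room for at most [n] sign changes, with equality only if every sign
   changes and no zero leads. *)
Lemma zcount_encode_bound n x : (0 < n)%N ->
  (pcount (encode x) <= n)%N -> (qcount (encode x) <= n)%N ->
  (zcount (encode x) <= n - 1)%N = (x != (false, alternating true n)).
Proof.
case: x => lead w n_gt0.
rewrite pcount_encode qcount_encode zcount_encode /= => lep leq'.
have pq := pqcount_interleave true w; have zle := zcount_interleave_le true w.
have zeq := zcount_interleave_eq true w.
apply/idP/idP => [zn|].
  apply/eqP => -[_ ew]; move: zeq; rewrite {2}ew size_alternating.
  have sw : size w = n by rewrite ew size_alternating.
  by rewrite sw {2}ew eqxx; lia.
apply: contraR => zn.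
have sw : size w = n by lia.
have -> : lead = false by lia.
apply/eqP; congr (_, _); apply/eqP; move: zeq; rewrite sw => <-; lia.
Qed.

(** * Codes and candidate sequences *)

Lemma interleave_inj c c' w w' :
  interleave c w = interleave c' w' -> c = c' /\ w = w'.
Proof.
have sgi_inj : injective sgi by case; case.
elim: w w' c c' => [|b w IHw] [|b' w'] c c' //= [] /sgi_inj -> //.
by move=> /IHw[-> ->].
Qed.

Lemma encode_inj : injective encode.
Proof.
move=> [[] w] [[] w']; rewrite /encode /=.
- by move=> [] /interleave_inj[_ ->].
- by case: w'.
- by case: w.
- by move=> /interleave_inj[_ ->].
Qed.

Lemma control_interleave c w : control_seqs (interleave c w).
Proof.
rewrite /control_seqs /=.
elim: w c => [|b w IHw] c; first by case: c.
have /and4P[_ h1 h2 h3] := IHw b.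
move: h1 h2 h3; rewrite /= (interleave_cons b w) /= => h1 h2 h3.
by rewrite h1 h2 h3; case: c; case: b {h1 h2 h3}.
Qed.

Lemma control_encode x : control_seqs (encode x).
Proof.
case: x => [[] w]; last exact: control_interleave.
have /and4P[_ h1 h2 h3] := control_interleave true w.
move: h1 h2 h3; rewrite /encode /control_seqs /=.
by rewrite (interleave_cons true w) /= => -> -> ->.
Qed.

(** After a sign comes a zero, which cannot be the last entry and so is followed by a sign. Each
    step thus strips two entries, whence the induction on a bound for the size. *)
Lemma control_interleaveP c s :
  control_seqs (sgi c :: s) -> exists w, sgi c :: s = interleave c w.
Proof.
have [m] := ubnP (size s); elim: m c s => // m IHm c [|x [|y s]] /=.
- by exists [::].
- by rewrite /control_seqs /= => _ /and3P[_ x0 /andP[cx _]];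
  by move: cx x0; case: c; case: (x == 0%R).
move=> /ltnSE/ltnW lt_sm; rewrite /control_seqs /= => /and3P[/and4P[_ _ yE sE] lE].
move=> /and3P[cx xy ys].
have x0 : x = 0%R by apply/eqP; move: cx; case: c.
have /orP[/eqP y1|/eqP y1] : (y == sgi true) || (y == sgi false).
- move: xy yE; rewrite x0 eqxx /= !inE => /negPf -> /=.
  by rewrite orbC.
- have [|w Ew] := IHm true s lt_sm; last by exists (true :: w); rewrite /= -Ew x0 y1.
  by rewrite -y1 /control_seqs /= yE sE lE.
- have [|w Ew] := IHm false s lt_sm; last by exists (false :: w); rewrite /= -Ew x0 y1.
  by rewrite -y1 /control_seqs /= yE sE lE.
Qed.

Lemma candidateE n : (0 < n)%N ->
  candidate n `&` (Splus n `|` short_seqs) =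
  encode @` [set x | [/\ (pcount (encode x) <= n)%N, (qcount (encode x) <= n)%N
                       & x != (false, alternating true n)]].
Proof.
move=> n_gt0; apply/seteqP; split => [s|_ [x [lep leq' xN] <-]].
  move=> [[cs /and3P[lep leq' lez]] Ss].
  have [x Ex] : exists x, s = encode x.
    have : prefix [:: (1 : int)%R] s \/ prefix [:: (0 : int)%R; 1%R] s.
      case: Ss => [[_ _ [_ [_ [_ [|]]]]]|[|]].
      - by move=> /prefixP[t ->]; left.
      - by move=> /prefixP[t ->]; right.
      - by move=> ->; left.
      - by move=> ->; right.
    case=> /prefixP[t Et]; move: cs; rewrite Et.
      by move=> /(control_interleaveP true)[w Ew]; exists (false, w).
    move=> ct; have /(control_interleaveP true)[w Ew] : control_seqs (1%R :: t).
      by case/and4P: ct => _ h1 h2 h3; apply/and4P; split.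
    by exists (true, w); rewrite /encode /= -Ew.
  by exists x => //=; rewrite -Ex -(zcount_encode_bound n) -?Ex.
split.
  by split; [exact: control_encode | rewrite lep leq' zcount_encode_bound].
(* The empty words code the two short sequences; any other word has at least two switchings, so
   [p + q > 1]. *)
have [w0|wN] := eqVneq x.2 [::].
  by right; case: x w0 {lep leq' xN} => [[] w] /= ->; [right|left].
left; exists (pcount (encode x), qcount (encode x)) => /=.
  rewrite lep leq' /= pcount_encode qcount_encode.
  have := pqcount_interleave true x.2.
  by case: x.2 wN => //= *; lia.
split; first exact: control_encode.
split=> //; split=> //.
by case: x wN {lep leq' xN} => [] [] [|b w] // _; [right|left]; case: w.
Qed.

(** * Words with bounded numbers of each sign *)

Fixpoint words (r : nat) : nat -> seq (seq bool) :=
  if r is r'.+1 then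
    fix words_r s := if s is s'.+1 then
      [::] :: map (cons true) (words r' s'.+1) ++ map (cons false) (words_r s')
    else [::]
  else fun=> [::].

Arguments words : simpl never.

Lemma wordsSS r s : words r.+1 s.+1 =
  [::] :: map (cons true) (words r s.+1) ++ map (cons false) (words r.+1 s).
Proof. by []. Qed.

Lemma words0 r : words r 0 = [::]. Proof. by case: r. Qed.

Lemma mem_words r s v :
  (v \in words r s) = (count id v < r)%N && (count negb v < s)%N.
Proof.
have consI (b : bool) : injective (cons b) by move=> ? ? [].
have consN b b' (t : seq (seq bool)) w : b != b' -> (b :: w \in map (cons b') t) = false.
  by move=> bb'; apply/mapP => -[u _ [e]]; rewrite e eqxx in bb'.
elim: v r s => [|b v IHv] [|r] [|s] //; rewrite ?words0 ?andbF // wordsSS inE /= mem_cat.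
case: b.
  by rewrite (consN true false) // (mem_map (consI true)) IHv orbF /=; lia.
by rewrite (consN false true) // (mem_map (consI false)) IHv /=; lia.
Qed.

Lemma words_uniq r s : uniq (words r s).
Proof.
have consI (b : bool) : injective (cons b) by move=> ? ? [].
elim: r s => [|r IHr] // s; elim: s => [|s IHs] //.
rewrite wordsSS cons_uniq cat_uniq !(map_inj_uniq (consI _)) IHr IHs andbT /=.
apply/andP; split; first by rewrite mem_cat; apply/norP; split; apply/mapP => -[].
by apply/hasPn => _ /mapP[w _ ->]; apply/mapP => -[].
Qed.

(** Pascal's rule, by the first letter of the word: the empty word supplies the extra 1 needed for
    the successor of the size to satisfy it. *)
Lemma size_words r s : (size (words r s)).+1 = 'C(r + s, r).
Proof.
elim: r s => [|r IHr] s; first by rewrite bin0.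
elim: s => [|s IHs]; first by rewrite addn0 binn.
rewrite wordsSS /= size_cat !size_map addSn binS.
by move: (IHr s.+1) IHs; rewrite addSn addnS; lia.
Qed.

(** * Enumeration of the codes *)

Lemma card_uniq_seq (T : eqType) (s : seq T) :
  uniq s -> [set` s] #= `I_(size s).
Proof.
case: s => [|x0 s] us; first by rewrite II0 set_nil.
set s' := x0 :: s in us *.
have -> : [set` s'] = nth x0 s' @` `I_(size s').
  apply/seteqP; split => [x /= /(nthP x0)[i lti <-]|_ [i lti <-]].
    by exists i.
  exact: mem_nth.
apply: inj_card_eq => i j; rewrite !inE => lti ltj /eqP.
by rewrite nth_uniq // => /eqP.
Qed.

(** The fixed entries use [x.1 + 1 + x.2] of [q] and [~~ x.2] of [p], and each interior sign uses
    two. Adding 2 makes the bounds strict; it also keeps the subtraction exact when [n = 1] and both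
    bits are true, where no word is left. *)
Definition qbound (n : nat) (x : bool * bool) := (n + 2 - (x.1 + (x.2).+1)) %/ 2.
Definition pbound (n : nat) (x : bool * bool) := (n + 2 - ~~ x.2) %/ 2.

Definition ends : seq (bool * bool) :=
  [:: (true, true); (false, true); (true, false); (false, false)].

(* A code with at least two signs is cut into its leading bit [x.1], its last
   sign [x.2] and the signs in between, of which fewer than [qbound n x] are +1
   and fewer than [pbound n x] are -1. *)
Definition long_codes (n : nat) : seq (bool * seq bool) :=
  [seq (x.1, rcons v x.2) | x <- ends, v <- words (qbound n x) (pbound n x)].

Definition codes (n : nat) : seq (bool * seq bool) :=
  [:: (false, [::]), (true, [::]) & long_codes n].

Lemma mem_codes n x : (0 < n)%N ->
  (x \in codes n) = (pcount (encode x) <= n)%N && (qcount (encode x) <= n)%N.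
Proof.
move=> n_gt0; rewrite pcount_encode qcount_encode.
case: x => lead w /=; case: (lastP w) => [|v l].
  by rewrite !inE; case: lead; rewrite ?n_gt0.
rewrite pcount_interleave_rcons qcount_interleave_rcons !inE.
rewrite ![(_, rcons v l) == _]/eq_op /= -!size_eq0 !size_rcons !andbF /=.
apply/(allpairsPdep (T := fun=> seq bool))/idP.
  move=> [[b l'] [u [_ uw [-> /rcons_inj[-> ->]]]]].
  by move: uw; rewrite mem_words /qbound /pbound /=; case: b; case: l' => /=; lia.
move=> pq; exists (lead, l), v; split=> //; first by case: lead {pq}; case: l.
rewrite mem_words /qbound /pbound /=.
by move: pq; case: lead; case: l => /=; lia.
Qed.

Lemma codes_uniq n : uniq (codes n).
Proof.
have nil_codes b : (b, [::]) \notin long_codes n.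
  by apply/negP => /(allpairsPdep (T := fun=> seq bool))[x [[|c v] [_ _ []]]].
rewrite /codes /= inE !nil_codes /=.
apply: (allpairs_uniq_dep (T := fun=> seq bool)) => // [x _|]; first exact: words_uniq.
by move=> [[b l] v] [[b' l'] v'] _ _ /= [-> /rcons_inj[-> ->]].
Qed.

(** Each of the four families has a binomial coefficient minus 1 elements, and the two empty words
    make up for half of that deficit of 4. *)
Lemma size_codes n : (0 < n)%N ->
  (size (codes n) + 2 =
   if odd n
   then 3 * 'C(n, (n - 1) %/ 2) + 'C(n + 1, (n + 1) %/ 2)
   else 'C(n, (n - 2) %/ 2) + 2 * 'C(n, n %/ 2) + 'C(n + 1, n %/ 2))%N.
Proof.
move=> n_gt0; rewrite /codes [size _]/= /long_codes size_allpairs_dep.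
pose size_at x := size (words (qbound n x) (pbound n x)).
have sizeE x k m : qbound n x + pbound n x = k -> qbound n x = m ->
    (size_at x).+1 = 'C(k, m).
  by move=> <- <-; exact: size_words.
rewrite -/size_at [sumn _]/=; clearbody size_at.
case: (odd n) (odd_double_half n) => /= nE.
  have ett : (size_at (true, true)).+1 = 'C(n, (n - 1) %/ 2).
    by apply: sizeE; rewrite /qbound /pbound /=; lia.
  have eft : (size_at (false, true)).+1 = 'C(n, (n - 1) %/ 2).
    by apply: sizeE; rewrite /qbound /pbound /=; lia.
  have etf : (size_at (true, false)).+1 = 'C(n, (n - 1) %/ 2).
    by apply: sizeE; rewrite /qbound /pbound /=; lia.
  have eff : (size_at (false, false)).+1 = 'C(n + 1, (n + 1) %/ 2).
    by apply: sizeE; rewrite /qbound /pbound /=; lia.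
  by clear -ett eft etf eff; lia.
have ett : (size_at (true, true)).+1 = 'C(n, (n - 2) %/ 2).
  by apply: sizeE; rewrite /qbound /pbound /=; lia.
have eft : (size_at (false, true)).+1 = 'C(n + 1, n %/ 2).
  by apply: sizeE; rewrite /qbound /pbound /=; lia.
have etf : (size_at (true, false)).+1 = 'C(n, n %/ 2).
  by apply: sizeE; rewrite /qbound /pbound /=; lia.
have eff : (size_at (false, false)).+1 = 'C(n, n %/ 2).
  by apply: sizeE; rewrite /qbound /pbound /=; lia.
by clear -ett eft etf eff; lia.
Qed.

Theorem theorem3 (n : nat) (n_gt0 : (0 < n)%N) :
  (candidate n `&` (Splus n `|` short_seqs)) #=
  `I_(if odd n
      then 3 * 'C(n, (n - 1) %/ 2) + 'C(n + 1, (n + 1) %/ 2) - 3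
      else 'C(n, (n - 2) %/ 2) + 2 * 'C(n, n %/ 2) + 'C(n + 1, n %/ 2) - 3)%N.
Proof.
rewrite candidateE //.
set N := (if _ then _ else _).
pose L := rem (false, alternating true n) (codes n).
(* This word has [p = n], and [p + q] is twice its length [n], so [q = n] as well. *)
have altL : (false, alternating true n) \in codes n.
  rewrite mem_codes // pcount_encode qcount_encode /= pcount_alternating leqnn.
  have := pqcount_interleave true (alternating true n).
  by rewrite pcount_alternating size_alternating; lia.
have -> : [set x | [/\ (pcount (encode x) <= n)%N, (qcount (encode x) <= n)%N
                     & x != (false, alternating true n)]] = [set` L].
  apply/seteqP; split => x; rewrite /= mem_rem_uniq ?codes_uniq // inE mem_codes //.
    by case=> -> -> ->.
  by move=> /and3P[].
apply: (card_eq_trans (inj_card_eq _)); first by move=> ? ? _ _; apply: encode_inj.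
have -> : N = size L.
  (* Of the 3 subtracted, 2 come from [size_codes] and 1 from the removed alternating code. *)
  have -> : N = (size (codes n) + 2 - 3)%N.
    by rewrite size_codes // /N; case: (odd n).
  by rewrite /L size_rem // addn2 subSS subn2.
exact/card_uniq_seq/rem_uniq/codes_uniq.
Qed.
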